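(* Let $z_0,z_1,z_2\in\mathbb{C}$ be the vertices of a nondegenerate triangle, with centroid $g=\frac13(z_0+z_1+z_2)$, and let $p(z)=(z-z_0)(z-z_1)(z-z_2)$. Identify $\mathbb{C}$ with $\mathbb{R}^2$ via $x+iy\leftrightarrow(x,y)^T$, let $u_i\in\mathbb{R}^2$ be the vector corresponding to $z_i-g$, and put $B=\frac16\sum_{i=0}^{2}u_iu_i^T$. Let $F:\mathbb{R}^2\to\mathbb{R}^2$ be the vector field $F(w)=Bw-\tfrac12\|w\|^2w$, with Jacobian $DF(w)=B-ww^T-\tfrac12\|w\|^2I$. Then for every $z\in\mathbb{C}$, $p'(z)=0$ if and only if $DF(w)$ has a repeated eigenvalue, where $w\in\mathbb{R}^2$ is the vector corresponding to $z-g$.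
   Context: $DF(w)$ denotes the Jacobian matrix of $F$ at $w$, a real symmetric $2\times2$ matrix; it has a repeated eigenvalue if its two eigenvalues (counted with multiplicity) coincide. $p'$ is the ordinary complex derivative of the polynomial $p$. *)

(* Defs.v *)
From HB Require Import structures.
From mathcomp Require Export all_boot all_order all_algebra.
From mathcomp Require Export complex.
From mathcomp Require Export all_classical all_reals all_analysis.

Set Implicit Arguments.
Unset Strict Implicit.
Unset Printing Implicit Defensive.

Import Order.TTheory GRing.Theory Num.Theory.
Export numFieldNormedType.Exports.

Local Open Scope ring_scope.
Local Open Scope complex_scope.
Local Open Scope classical_set_scope.

Definition collinear (R : realType) (z : 'I_3 -> R[i]) : Prop :=
  exists a d : R[i], d != 0 /\ forall i, exists t : R, z i = a + t%:C * d.

Definition nondegenerate_triangle (R : realType) (z : 'I_3 -> R[i]) : Prop :=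
  ~ collinear z.

Definition vec_of_complex (R : realType) (z : R[i]) : 'cV[R]_2 :=
  \col_(i < 2) (if i == 0 then complex.Re z else complex.Im z).

(* The library's norm `|w| on matrices is the maximum norm. *)
Definition euclidean_norm (R : realType) (n : nat) (w : 'cV[R]_n) : R :=
  Num.sqrt (\sum_(i < n) w i 0 ^+ 2).

(* The library's 'J is the Jacobian of maps between row vectors, i.e. the
   transpose of the usual one; this is the usual Jacobian (partial derivative
   of the i-th component along the j-th axis) for maps between column
   vectors. *)
Definition cjacobian (R : realType) (m n : nat)
    (f : 'cV[R]_n -> 'cV[R]_m) (w : 'cV[R]_n) : 'M[R]_(m, n) :=
  \matrix_(i < m, j < n) 'D_(delta_mx j 0) (fun v : 'cV[R]_n => f v i 0) w.

(* Some eigenvalue occurs at least twice when eigenvalues are counted with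
   (algebraic) multiplicity. *)
Definition has_repeated_eigenvalue (R : realType) (n : nat)
    (A : 'M[R]_n) : Prop :=
  exists a : R, eigenvalue A a /\ (2 <= mup a (char_poly A))%N.

(* The derivative of a function of one complex variable, as the limit of
   complex difference quotients; R[i]^o is R[i] as a normed module over
   itself (R[i] alone is also a module over R). *)
Definition complex_derivative (R : realType) (f : R[i] -> R[i]) (z : R[i]) :
    R[i] :=
  (f : R[i] -> R[i]^o)^`()%classic z.

(* Main.v *)
Require Import Defs.
From HB Require Import structures.
From mathcomp Require Import ring.
Import Order.TTheory GRing.Theory Num.Theory.
Local Open Scope ring_scope.
Local Open Scope complex_scope.

(** The space of real symmetric 2 x 2 matrices modulo scalar matrices is a real
    plane. The map [deviator], sending [A] to the complex number
    [(A 0 0 - A 1 1) + 2 i A 0 1], identifies it with the complex line in such a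
    way that [w w^T] goes to the complex square of [w] ([deviator_outer]). A
    symmetric matrix has a repeated eigenvalue exactly when it is scalar, that
    is, when its deviator vanishes ([repeated_eigenvalue_deviatorP]).

    Apply this to the Jacobian [B - w w^T - |w|^2 / 2 I] at the vector [w] of
    [zeta - g]. The isotropic term disappears, and additivity gives the deviator
    [1/6 \sum_i (z_i - g)^2 - (zeta - g)^2]. Since the [z_i - g] add up to zero,
    the second elementary symmetric function of them is
    [- 1/2 \sum_i (z_i - g)^2], so the derivative of the cubic at [zeta] is
    [3 ((zeta - g)^2 - 1/6 \sum_i (z_i - g)^2)] ([deriv_cubic_centroid]). Hence
    the deviator of the Jacobian is [- p'(zeta) / 3], and the two vanish
    together.

    The remaining work connects the analytic derivatives with these formulas:
    [complex_derivative_horner] for [p], and [differentiable_cubic_vector_field]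
    and [cjacobian_cubic_vector_field] for [F]. *)

(** * Derivatives of polynomials *)

Lemma is_derive_horner {K : numFieldType} (p : {poly K}) (x : K) :
  is_derive x 1 (horner p : K -> K^o) p^`().[x].
Proof.
elim/poly_ind: p => [|p c ih].
  rewrite deriv0 horner0.
  have -> : horner (0 : {poly K}) = cst 0 by apply/funext => y; rewrite horner0.
  exact: is_derive_cst.
have -> : horner (p * 'X + c%:P) = (horner p : K -> K^o) * id + cst c.
  by apply/funext => y; rewrite !hornerE.
apply: is_derive_eq.
by rewrite derivD derivC derivM derivX !hornerE /= /GRing.scale /=; ring.
Qed.

Lemma complex_derivative_horner {R : realType} (p : {poly R[i]}) (x : R[i]) :
  complex_derivative (horner p) x = p^`().[x].
Proof.
rewrite /complex_derivative derive1E.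
have ? := is_derive_horner p x; exact: derive_val.
Qed.

(** * Repeated eigenvalues of symmetric matrices of order two *)

(** If [a] is a double root, the characteristic polynomial is [('X - a) ^ 2], so
    its discriminant vanishes; for a symmetric matrix the discriminant is the
    sum of squares [(A 0 0 - A 1 1)^2 + (2 A 0 1)^2]. *)
Lemma symmetric_repeated_eigenvalueP {R : realType} (A : 'M[R]_2) :
  A^T = A ->
  has_repeated_eigenvalue A <-> A 0 0 = A 1 1 /\ A 0 1 = 0.
Proof.
move=> /matrixP symA; have A10 : A 1 0 = A 0 1 by rewrite -symA mxE.
split=> [[a [_]]|[A00 A01]].
  rewrite mup_geq ?monic_neq0 ?char_poly_monic // => dvd_chi.
  have chiE : ('X - a%:P) ^+ 2 = char_poly A.
    apply/eqP; rewrite -eqp_monic ?monic_exp ?monicXsubC ?char_poly_monic //.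
    by rewrite -dvdp_size_eqp // size_exp_XsubC size_char_poly.
  have trE : A 0 0 + A 1 1 = 2 * a.
    have -> : A 0 0 + A 1 1 = \tr A.
      rewrite /mxtrace !big_ord_recl big_ord0 addr0.
      by congr (_ + A _ _); apply/val_inj.
    apply: oppr_inj; rewrite -(char_poly_trace _ (isT : 0 < 2)%N) -chiE.
    by rewrite sqrrB !coefE /=; ring.
  have detE : A 0 0 * A 1 1 - A 0 1 ^+ 2 = a ^+ 2.
    have -> : A 0 0 * A 1 1 - A 0 1 ^+ 2 = \det A.
      rewrite (expand_det_row _ 0) !big_ord_recl big_ord0 /cofactor.
      rewrite !det_mx11 !mxE /=.
      have -> : lift 0 (0 : 'I_1) = 1 :> 'I_2 by exact/val_inj.
      have -> : lift 1 (0 : 'I_1) = 0 :> 'I_2 by exact/val_inj.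
      by rewrite A10 /= expr0 expr1; ring.
    have := char_poly_det A; rewrite -chiE sqrrB !coefE /=.
    by rewrite sqrrN expr1n mul1r => <-; ring.
  (* The discriminant, as a sum of squares. *)
  have : (A 0 0 - A 1 1) ^+ 2 + (2 * A 0 1) ^+ 2 == 0.
    apply/eqP.
    transitivity ((A 0 0 + A 1 1) ^+ 2 - 4 * (A 0 0 * A 1 1 - A 0 1 ^+ 2)).
      by ring.
    by rewrite trE detE; ring.
  rewrite paddr_eq0 ?sqr_ge0 // !sqrf_eq0 subr_eq0 mulf_eq0 pnatr_eq0 /=.
  by case/andP=> /eqP ? /eqP ?.
have diagA i j : A i j = (A 0 0) *+ (i == j).
  case: i j => [[|[|//]] Hi] [[|[|//]] Hj]; rewrite /= ?mulr1n ?mulr0n.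
  - congr (A _ _); exact/val_inj.
  - rewrite -A01; congr (A _ _); exact/val_inj.
  - rewrite -A01 -A10; congr (A _ _); exact/val_inj.
  - rewrite A00; congr (A _ _); exact/val_inj.
have chiE : char_poly A = ('X - (A 0 0)%:P) ^+ 2.
  rewrite char_poly_trig; last first.
    by apply/is_trig_mxP => i j; rewrite diagA; case: eqP => // ->; rewrite ltnn.
  rewrite (eq_bigr (fun=> 'X - (A 0 0)%:P)) ?prodr_const ?card_ord // => i _.
  by rewrite (diagA i i) eqxx.
exists (A 0 0); split.
  by rewrite eigenvalue_root_char chiE rootE horner_exp hornerXsubC subrr expr0n.
by rewrite chiE mup_XsubCX eqxx.
Qed.

(** * The vector field and its Jacobian *)

Lemma euclidean_norm_sqr {R : realType} n (w : 'cV[R]_n) :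
  euclidean_norm w ^+ 2 = \sum_(i < n) w i 0 ^+ 2.
Proof. by rewrite sqr_sqrtr // sumr_ge0 // => i _; rewrite sqr_ge0. Qed.

Definition cubic_vector_field {R : realType} {n : nat} (B : 'M[R]_n)
    (w : 'cV[R]_n) : 'cV[R]_n :=
  B *m w - (2^-1 * euclidean_norm w ^+ 2) *: w.

Definition coordinate {R : realType} {n : nat} (i : 'I_n) (v : 'cV[R]_n) : R :=
  v i 0.

(** Each component is a polynomial in the coordinate functions, written with the
    pointwise operations on functions so that the differentiation rules for sums
    and products apply; squaring removes the square root in the norm. *)
Lemma cubic_vector_field_coordinate {R : realType} n (B : 'M[R]_n) i :
  (fun v => cubic_vector_field B v i 0) =
  (\sum_(k < n) B i k *: coordinate k)
  - (2^-1 *: \sum_(k < n) coordinate k ^+ 2) * coordinate i.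
Proof.
apply/funext => v; rewrite /cubic_vector_field euclidean_norm_sqr !mxE.
by rewrite !fctE !fct_sumE.
Qed.

Lemma differentiable_col {R : realType} (V : normedModType R) n
    (f : V -> 'cV[R]_n) x :
  (forall i, differentiable (fun v => f v i 0) x) -> differentiable f x.
Proof.
move=> df.
have -> : f = \sum_(i < n) fun v => f v i 0 *: delta_mx i 0.
  apply/funext => v; rewrite fct_sumE {1}[f v]matrix_sum_delta.
  by apply: eq_bigr => i _; rewrite big_ord1.
by apply: differentiable_sum => i; apply: differentiableZl.
Qed.

Lemma differentiable_cubic_vector_field {R : realType} n (B : 'M[R]_n) w :
  differentiable (cubic_vector_field B) w.
Proof.
apply: differentiable_col => i; rewrite cubic_vector_field_coordinate.
have dc (k : 'I_n) : differentiable (coordinate k : 'cV[R]_n -> R) w.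
  exact: differentiable_coord.
apply: differentiableB.
  by apply: differentiable_sum => k; apply: differentiableZ.
apply: differentiableM => //; apply: differentiableZ.
by apply: differentiable_sum => k; apply: differentiableX.
Qed.

Lemma is_derive_coordinate {R : realType} {n} (k j : 'I_n) (w : 'cV[R]_n) :
  is_derive w (delta_mx j 0) (coordinate k) (k == j)%:R.
Proof.
apply: DeriveDef; first exact/diff_derivable/differentiable_coord.
have lin_c : linear (coordinate k : 'cV[R]_n -> R).
  by move=> a u v; rewrite /coordinate !mxE.
pose cM := GRing.isLinear.Build _ _ _ _ _ lin_c.
pose c : {linear 'cV[R]_n -> R} := HB.pack (coordinate k : 'cV[R]_n -> R) cM.
rewrite deriveE; last exact: differentiable_coord.
rewrite (@diff_lin _ _ _ c).
  by rewrite /= /coordinate mxE eqxx andbT.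
exact: coord_continuous.
Qed.

Lemma cjacobian_cubic_vector_field {R : realType} n (B : 'M[R]_n) w :
  cjacobian (cubic_vector_field B) w =
  B - w *m w^T - (2^-1 * euclidean_norm w ^+ 2) *: 1%:M.
Proof.
apply/matrixP => i j; rewrite mxE cubic_vector_field_coordinate.
have dc k := is_derive_coordinate k j w.
have pick (f : 'I_n -> R) : \sum_(k < n) f k *: (k == j)%:R = f j.
  rewrite (bigD1 j) //= eqxx [_ *: _]mulr1 big1 ?addr0 // => k /negbTE ->.
  exact: mulr0.
rewrite derive_val !pick euclidean_norm_sqr !mxE big_ord1 !mxE.
rewrite !fctE fct_sumE /coordinate /GRing.scale /= expr1.
under eq_bigr do rewrite exprfctE.
by field.
Qed.

(** * The trace-free part as a complex number *)

(** Half of this number encodes the trace-free part of a symmetric matrix: the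
    real part gives its diagonal and the imaginary part its off-diagonal
    entry. *)
Definition deviator {R : realType} (A : 'M[R]_2) : R[i] :=
  (A 0 0 - A 1 1) +i* (2 * A 0 1).

Fact deviator_is_zmod_morphism {R : realType} : zmod_morphism (@deviator R).
Proof. by move=> A B; rewrite /deviator !mxE; simpc; congr (_ +i* _); ring. Qed.

HB.instance Definition _ (R : realType) :=
  GRing.isZmodMorphism.Build 'M[R]_2 R[i] deviator deviator_is_zmod_morphism.

Lemma deviatorZ {R : realType} (a : R) (A : 'M[R]_2) :
  deviator (a *: A) = a%:C * deviator A.
Proof. by rewrite /deviator !mxE; simpc; congr (_ +i* _); ring. Qed.

Lemma deviator_scalar {R : realType} (a : R) :
  deviator (a *: 1%:M : 'M[R]_2) = 0.
Proof. by rewrite /deviator !mxE /=; congr (_ +i* _); ring. Qed.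

(** For [c = x + i y], the entries of the outer product are [x^2], [y^2] and
    [x y], and [c ^ 2 = (x^2 - y^2) + 2 i x y]. *)
Lemma deviator_outer {R : realType} (c : R[i]) :
  deviator (vec_of_complex c *m (vec_of_complex c)^T) = c ^+ 2.
Proof.
case: c => x y; rewrite /deviator !mxE !big_ord1 !mxE expr2 /=; simpc.
by congr (_ +i* _); ring.
Qed.

Lemma repeated_eigenvalue_deviatorP {R : realType} (A : 'M[R]_2) :
  A^T = A -> has_repeated_eigenvalue A <-> deviator A = 0.
Proof.
move=> symA; rewrite (symmetric_repeated_eigenvalueP _ symA).
split=> [[A00 A01]|/eqP]; first by rewrite /deviator A00 A01 subrr mulr0.
rewrite eq_complex /= subr_eq0 mulf_eq0 pnatr_eq0 /=.
by case/andP=> /eqP ? /eqP ?.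
Qed.

(** * The derivative of a cubic around the centroid of its roots *)

(** In the variable [x - g] the cubic has no quadratic term, so its derivative
    has no linear term. The constant term of the derivative, the second
    elementary symmetric function of the [z i - g], is minus half their sum of
    squares. *)
Lemma deriv_cubic_centroid {K : numFieldType} (z : 'I_3 -> K) (x : K) :
  let g := 3^-1 * \sum_(i < 3) z i in
  (\prod_(i < 3) ('X - (z i)%:P))^`().[x] =
  3 * ((x - g) ^+ 2 - 6^-1 * \sum_(i < 3) (z i - g) ^+ 2).
Proof.
have sum3 (f : 'I_3 -> K) :
    \sum_(i < 3) f i =
      f ord0 + f (lift ord0 ord0) + f (lift ord0 (lift ord0 ord0)).
  by rewrite !big_ord_recl big_ord0 addr0 addrA.
rewrite /= !sum3 !big_ord_recl big_ord0 mulr1 !derivM !derivXsubC /=.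
rewrite !mul1r !mulr1 !(hornerD, hornerM, hornerN, hornerX, hornerC).
by field.
Qed.

Theorem mainTheorem2 (R : realType) (z : 'I_3 -> R[i])
    (hz : nondegenerate_triangle z) :
  let g : R[i] := 3^-1 * \sum_(i < 3) z i in
  let p : {poly R[i]} := \prod_(i < 3) ('X - (z i)%:P) in
  let u (i : 'I_3) : 'cV[R]_2 := vec_of_complex (z i - g) in
  let B : 'M[R]_2 := 6^-1 *: \sum_(i < 3) u i *m (u i)^T in
  let F (w : 'cV[R]_2) : 'cV[R]_2 :=
    B *m w - (2^-1 * euclidean_norm w ^+ 2) *: w in
  (forall w : 'cV[R]_2,
     differentiable F w /\
     cjacobian F w = B - w *m w^T - (2^-1 * euclidean_norm w ^+ 2) *: 1%:M) /\
  (forall zeta : R[i],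
     complex_derivative (horner p) zeta = 0 <->
     has_repeated_eigenvalue (cjacobian F (vec_of_complex (zeta - g)))).
Proof.
move=> g p u B F; split=> [w|zeta].
  split; first exact: differentiable_cubic_vector_field.
  exact: cjacobian_cubic_vector_field.
set w := vec_of_complex (zeta - g).
have symB : B^T = B.
  rewrite /B linearZ linear_sum; congr (_ *: _); apply: eq_bigr => i _.
  by rewrite /= trmx_mul trmxK.
have symJ : (cjacobian F w)^T = cjacobian F w.
  rewrite cjacobian_cubic_vector_field !linearB /= symB trmx_mul trmxK.
  by rewrite scalemx1 tr_scalar_mx.
have devB : deviator B = 6^-1 * \sum_(i < 3) (z i - g) ^+ 2.
  rewrite deviatorZ raddf_sum rmorphV ?unitfE ?pnatr_eq0 // rmorph_nat.
  by congr (_ * _); apply: eq_bigr => i _; exact: deviator_outer.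
have devJ :
    deviator (cjacobian F w) = - 3^-1 * complex_derivative (horner p) zeta.
  rewrite cjacobian_cubic_vector_field complex_derivative_horner.
  rewrite deriv_cubic_centroid.
  rewrite -/g !raddfB /= deviator_scalar deviator_outer devB.
  by field.
rewrite (repeated_eigenvalue_deviatorP _ symJ) devJ.
split=> [->|/eqP]; first by rewrite mulr0.
by rewrite mulf_eq0 oppr_eq0 invr_eq0 pnatr_eq0 /= => /eqP.
Qed.
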